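(* The topological $2$-valued group $\mathcal{X}_{\mathbb{C}}$ cannot be obtained from a topological group via the coset construction. That is, there do not exist a topological group $G$, a group $H$ of order $2$ and a homomorphism $\psi:H\to\operatorname{Aut}(G)$ to the group of automorphisms of the topological group $G$ such that $\mathcal{X}_{\mathbb{C}}$ is isomorphic, as a topological $2$-valued group, to the coset group $G/\psi(H)$.
   Context: Let $\iota$ denote the involution $f\mapsto -f$; $[a]$ with a single entry denotes an equivalence class (for $\iota$ it is $\{a,-a\}$), and $[x_1,\dots,x_k]$ with $k\geq 2$, or $[x_h]_{h\in H}$, denotes a multiset. $\mathcal{X}_{\mathbb{C}}$ is the $2$-valued group $(\mathbb{C}/\iota)\times(\mathbb{C}^\times/\iota)$, with the product of the quotient topologies and the operation $$([a],[b])*([c],[d])=\bigl[([a+bc],[bd]),([a-bc],[bd])\bigr].$$ Coset construction: for a group $G$ and a homomorphism $\psi:H\to\operatorname{Aut}(G)$ from a group $H$ of order $n$, the coset group $G/\psi(H)$ is the set of orbits of $G$ under $H$ with the $n$-valued operation $[g_1]*[g_2]=[\,[g_1\psi(h)(g_2)]\,]_{h\in H}$, where $[g]$ is the orbit of $g$. If $G$ is a topological group, automorphisms are automorphisms of the topological group (i.e. also homeomorphisms) and $G/\psi(H)$ carries the quotient topology. An isomorphism of $2$-valued groups is a bijection $f$ such that $f(x)*f(y)$ is the image multiset $f(x*y)$ for all $x,y$; for topological $2$-valued groups it is additionally required to be a homeomorphism. *)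

(* Defs.v *)
From HB Require Import structures.
From mathcomp Require Import all_fingroup all_boot all_order all_algebra.
From mathcomp Require Import finmap multiset complex.
From mathcomp Require Import all_classical all_reals all_analysis.
Import numFieldNormedType.Exports.

Set Implicit Arguments.
Unset Strict Implicit.
Unset Printing Implicit Defensive.

Import GRing.Theory.
Local Open Scope quotient_scope.
Local Open Scope mset_scope.
Local Open Scope classical_set_scope.
Local Open Scope ring_scope.

(* No separation axiom is imposed on topological groups. *)

HB.structure Definition NbhsGroup := {G of Group G & Nbhs G}.

HB.structure Definition PreTopologicalGroup := {G of Group G & Topological G}.

HB.mixin Record PreTopologicalGroup_isTopologicalGroup G
    of PreTopologicalGroup G := {
  mulg_continuous : continuous (fun x : G * G => (x.1 * x.2)%g);
  invg_continuous : continuous (fun x : G => (x^-1)%g)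
}.

#[short(type="topologicalGroupType")]
HB.structure Definition TopologicalGroup :=
  {G of PreTopologicalGroup G & PreTopologicalGroup_isTopologicalGroup G}.

Definition homeomorphism (X Y : topologicalType) (f : X -> Y) : Prop :=
  continuous f /\
  exists g : Y -> X, [/\ cancel f g, cancel g f & continuous g].

Section TopologicalAutomorphisms.
Variable G : topologicalGroupType.

Definition is_top_aut (f : G -> G) : Prop :=
  {morph f : x y / (x * y)%g} /\ homeomorphism f.

Record topAut := TopAut {
  topaut_fun :> G -> G;
  topaut_subproof : `[< is_top_aut topaut_fun >] }.

HB.instance Definition _ := [isSub for topaut_fun].
HB.instance Definition _ := [Choice of topAut by <:].

Lemma topautP (f : topAut) : is_top_aut f.
Proof. exact/asboolP/(valP f). Qed.

Lemma topaut_eq (f g : topAut) : f =1 g -> f = g.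
Proof. by move=> fg; apply/val_inj/funext. Qed.

Lemma is_top_aut_id : is_top_aut id.
Proof.
have idc : continuous (@idfun G) by move=> x; exact: cvg_id.
by split; [|split; [|exists idfun; split]].
Qed.

Lemma is_top_aut_comp (f g : G -> G) :
  is_top_aut f -> is_top_aut g -> is_top_aut (f \o g).
Proof.
move=> [fM [fc [f' [fK f'K f'c]]]] [gM [gc [g' [gK g'K g'c]]]]; split.
  by move=> x y /=; rewrite gM fM.
have ctsC (u v : G -> G) : continuous u -> continuous v -> continuous (u \o v).
  by move=> uc vc x; apply: continuous_comp; [exact: vc|exact: uc].
split; first exact: ctsC.
by exists (g' \o f'); split; [exact: can_comp|exact: can_comp|exact: ctsC].
Qed.

Lemma topaut_inv_ex (f : topAut) :
  exists2 g : G -> G, is_top_aut g & cancel f g /\ cancel g f.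
Proof.
have [fM [fc [g [fK gK gc]]]] := topautP f; exists g => //; split.
  by move=> x y; apply: (can_inj fK); rewrite fM !gK.
by split=> //; exists f.
Qed.

Definition topaut1 : topAut := TopAut (asboolT is_top_aut_id).

Definition topautM (f g : topAut) : topAut :=
  TopAut (asboolT (is_top_aut_comp (topautP f) (topautP g))).

Definition topautV (f : topAut) : topAut :=
  TopAut (asboolT (s2valP (cid2 (topaut_inv_ex f)))).

Lemma topautKV (f : topAut) : cancel f (topautV f).
Proof. exact: (s2valP' (cid2 (topaut_inv_ex f))).1. Qed.

Lemma topautVK (f : topAut) : cancel (topautV f) f.
Proof. exact: (s2valP' (cid2 (topaut_inv_ex f))).2. Qed.

Fact topautA : associative topautM. Proof. by move=> f g h; exact: topaut_eq. Qed.
Fact topaut1M : left_id topaut1 topautM. Proof. by move=> f; exact: topaut_eq. Qed.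
Fact topautM1 : right_id topaut1 topautM. Proof. by move=> f; exact: topaut_eq. Qed.
Fact topautVM : left_inverse topaut1 topautV topautM.
Proof. by move=> f; apply: topaut_eq => x; exact: topautKV. Qed.
Fact topautMV : right_inverse topaut1 topautV topautM.
Proof. by move=> f; apply: topaut_eq => x; exact: topautVK. Qed.

(* The product of two automorphisms is f * g = f \o g (not the diagrammatic   *)
(* order used for permutations).                                              *)
HB.instance Definition _ :=
  isGroup.Build topAut topautA topaut1M topautM1 topautVM topautMV.

End TopologicalAutomorphisms.

(* An n-valued operation on X is encoded as a map X -> X -> {mset X} whose    *)
(* values have n elements, counted with multiplicity.                         *)

Definition mset_image (X Y : choiceType) (f : X -> Y) (A : {mset X}) : {mset Y} :=
  seq_mset [seq f x | x <- enum_mset A].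

Definition top_multivalued_iso (X Y : topologicalType)
    (mulX : X -> X -> {mset X}) (mulY : Y -> Y -> {mset Y}) (f : X -> Y) : Prop :=
  homeomorphism f /\
  forall x y : X, mulY (f x) (f y) = mset_image f (mulX x y).

Definition top_multivalued_isomorphic (X Y : topologicalType)
    (mulX : X -> X -> {mset X}) (mulY : Y -> Y -> {mset Y}) : Prop :=
  exists f : X -> Y, top_multivalued_iso mulX mulY f.

Section Coset.
Variables (G : topologicalGroupType) (H : finGroupType).
Variable psi : {multiplicative H -> topAut G}.

Definition orbit_rel : rel G := fun x y => [exists h : H, psi h x == y].

Lemma psiM (h k : H) (x : G) : psi (h * k)%g x = psi h (psi k x).
Proof. by rewrite gmulfM. Qed.

Lemma psi1 (x : G) : psi 1%g x = x.
Proof. by apply: (can_inj (topautKV (psi 1%g))); rewrite -psiM mulg1. Qed.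

Lemma psi_morph (h : H) : {morph psi h : x y / (x * y)%g}.
Proof. exact: (topautP (psi h)).1. Qed.

Fact orbit_rel_refl : reflexive orbit_rel.
Proof. by move=> x; apply/existsP; exists 1%g; rewrite psi1. Qed.

Fact orbit_rel_sym : symmetric orbit_rel.
Proof.
suff sub x y : orbit_rel x y -> orbit_rel y x by move=> x y; apply/idP/idP => /sub.
move=> /existsP[h /eqP <-]; apply/existsP; exists (h^-1)%g.
by rewrite -psiM mulVg psi1.
Qed.

Fact orbit_rel_trans : transitive orbit_rel.
Proof.
move=> y x z /existsP[h /eqP <-] /existsP[k /eqP <-].
by apply/existsP; exists (k * h)%g; rewrite psiM.
Qed.

Canonical orbit_equiv :=
  EquivRel orbit_rel orbit_rel_refl orbit_rel_sym orbit_rel_trans.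

Definition coset_group : topologicalType :=
  quotient_topology {eq_quot orbit_equiv}.

Definition orbit_class (g : G) : coset_group := \pi_{eq_quot orbit_equiv} g.

Definition orbit_repr (x : coset_group) : G :=
  repr (x : {eq_quot orbit_equiv}).

(* Defined on representatives; coset_group_mulE shows that the choice is immaterial. *)
Definition coset_group_mul (x y : coset_group) : {mset coset_group} :=
  seq_mset
    [seq orbit_class (orbit_repr x * psi h (orbit_repr y))%g | h <- enum H].

Lemma orbit_classE (g k : G) :
  (orbit_class g = orbit_class k) <-> exists h, psi h g = k.
Proof.
split=> [/eqmodP/existsP[h /eqP]|[h hE]]; first by exists h.
by apply/eqmodP/existsP; exists h; apply/eqP.
Qed.

Lemma orbit_reprK (x : coset_group) : orbit_class (orbit_repr x) = x.
Proof. exact: (@reprK _ {eq_quot orbit_equiv}). Qed.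

Lemma perm_enum_bij (f : H -> H) : injective f ->
  perm_eq [seq f h | h <- enum H] (enum H).
Proof.
move=> fI; apply: uniq_perm; [by rewrite map_inj_uniq// enum_uniq|exact: enum_uniq|].
move=> h; rewrite mem_enum inE; apply/mapP; exists (invF fI h).
  by rewrite mem_enum.
by rewrite f_invF.
Qed.

Lemma coset_group_mulE (g k : G) :
  coset_group_mul (orbit_class g) (orbit_class k) =
  seq_mset [seq orbit_class (g * psi h k)%g | h <- enum H].
Proof.
have [a aE] := (orbit_classE _ _).1 (esym (orbit_reprK (orbit_class g))).
have [b bE] := (orbit_classE _ _).1 (esym (orbit_reprK (orbit_class k))).
have fI : injective (fun h => a^-1 * h * b)%g by move=> x y /mulIg/mulgI.
rewrite /coset_group_mul -aE -bE; apply/eq_seq_msetP.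
rewrite perm_sym -(permPl (perm_map _ (perm_enum_bij fI))) -map_comp.
rewrite (eq_map (g := fun h => orbit_class (psi a g * psi h (psi b k))%g))// => h.
apply/orbit_classE; exists a.
by rewrite psi_morph -!psiM !mulgA mulgV mul1g.
Qed.

End Coset.

Arguments orbit_class {G H} psi g.
Arguments coset_group_mul {G H} psi x y.

Section InvolutionQuotient.
Variables (T : topologicalType) (iota : T -> T) (iotaK : involutive iota).

Definition iota_rel of involutive iota : rel T :=
  fun x y => (x == y) || (x == iota y).

Fact iota_rel_refl : reflexive (iota_rel iotaK).
Proof. by move=> x; rewrite /iota_rel eqxx. Qed.

Fact iota_rel_sym : symmetric (iota_rel iotaK).
Proof.
by move=> x y; rewrite /iota_rel eq_sym [y == iota x]eq_sym (inv_eq iotaK).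
Qed.

Fact iota_rel_trans : transitive (iota_rel iotaK).
Proof.
move=> y x z /orP[]/eqP-> /orP[]/eqP->; rewrite /iota_rel ?iotaK ?eqxx ?orbT//.
Qed.

Canonical iota_equiv :=
  EquivRel (iota_rel iotaK) iota_rel_refl iota_rel_sym iota_rel_trans.

Definition iota_quot : topologicalType :=
  quotient_topology {eq_quot iota_equiv}.

Definition iota_class (x : T) : iota_quot := \pi_{eq_quot iota_equiv} x.

Definition iota_repr (x : iota_quot) : T := repr (x : {eq_quot iota_equiv}).

Lemma iota_classE (x y : T) :
  iota_class x = iota_class y <-> x = y \/ x = iota y.
Proof.
split=> [/eqmodP/orP[]/eqP|xy]; [by left|by right|].
by apply/eqmodP/orP; case: xy => ->; [left|right].
Qed.

Lemma iota_reprK (x : iota_quot) : iota_class (iota_repr x) = x.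
Proof. exact: (@reprK _ {eq_quot iota_equiv}). Qed.

End InvolutionQuotient.

Section XC.
Variable R : realType.

(* R[i] through its numFieldType structure, which carries the topology of the *)
(* norm.                                                                      *)
Definition C : numClosedFieldType := R[i].

(* set_type carries the subspace topology.                                    *)
Definition Cstar : topologicalType := set_type [set z : C | z != 0].

Definition mkCstar (z : C) (z0 : z != 0) : Cstar :=
  exist (fun x => x \in [set z : C | z != 0]) z (mem_set z0).

Lemma Cstar_neq0 (b : Cstar) : set_val b != 0.
Proof. exact: set_mem (valP b). Qed.

Fact CstarN_subproof (b : Cstar) : - set_val b != 0.
Proof. by rewrite oppr_eq0 Cstar_neq0. Qed.

Fact CstarM_subproof (b d : Cstar) : set_val b * set_val d != 0.
Proof. by rewrite mulf_neq0 ?Cstar_neq0. Qed.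

Definition CstarN (b : Cstar) : Cstar := mkCstar (CstarN_subproof b).
Definition CstarM (b d : Cstar) : Cstar := mkCstar (CstarM_subproof b d).

Lemma CstarNK : involutive CstarN.
Proof. by move=> b; apply/val_inj; rewrite /= opprK. Qed.

Definition C_iota : topologicalType := iota_quot (@opprK C).
Definition Cstar_iota : topologicalType := iota_quot CstarNK.

Definition XC : topologicalType := (C_iota * Cstar_iota)%type.

Definition XC_class (a : C) (b : Cstar) : XC :=
  (iota_class (@opprK C) a, iota_class CstarNK b).

(* Defined on representatives; XC_mulE shows that the choice is immaterial.   *)
Definition XC_mul (x y : XC) : {mset XC} :=
  let a := iota_repr x.1 in let b := iota_repr x.2 in
  let c := iota_repr y.1 in let d := iota_repr y.2 in
  [mset XC_class (a + set_val b * c) (CstarM b d);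
        XC_class (a - set_val b * c) (CstarM b d)].

Lemma XC_mulE (a c : C) (b d : Cstar) :
  XC_mul (XC_class a b) (XC_class c d) =
  [mset XC_class (a + set_val b * c) (CstarM b d);
        XC_class (a - set_val b * c) (CstarM b d)].
Proof.
have classN a' b' : XC_class (- a') b' = XC_class a' b'.
  by congr pair; apply/iota_classE; right.
have classNr a' b' : XC_class a' (CstarN b') = XC_class a' b'.
  by congr pair; apply/iota_classE; right.
have MN b' d' : CstarM (CstarN b') d' = CstarN (CstarM b' d').
  by apply/val_inj; rewrite /= mulNr.
have MNr b' d' : CstarM b' (CstarN d') = CstarN (CstarM b' d').
  by apply/val_inj; rewrite /= mulrN.
have classND u v b' : XC_class (- u - v) b' = XC_class (u + v) b'.
  by rewrite -classN opprD !opprK.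
have classNB u v b' : XC_class (- u + v) b' = XC_class (u - v) b'.
  by rewrite -classN opprD opprK.
pose P a' c' b' d' : {mset XC} :=
  [mset XC_class (a' + set_val b' * c') (CstarM b' d');
        XC_class (a' - set_val b' * c') (CstarM b' d')].
have PNa a' c' b' d' : P (- a') c' b' d' = P a' c' b' d'.
  by rewrite /P classNB classND msetDC.
have PNc a' c' b' d' : P a' (- c') b' d' = P a' c' b' d'.
  by rewrite /P mulrN opprK msetDC.
have PNb a' c' b' d' : P a' c' (CstarN b') d' = P a' c' b' d'.
  by rewrite /P MN !classNr mulNr opprK msetDC.
have PNd a' c' b' d' : P a' c' b' (CstarN d') = P a' c' b' d'.
  by rewrite /P MNr !classNr.
change (P (iota_repr (iota_class (@opprK C) a))
          (iota_repr (iota_class (@opprK C) c))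
          (iota_repr (iota_class CstarNK b))
          (iota_repr (iota_class CstarNK d)) = P a c b d).
have [] := (iota_classE _ _ _).1 (iota_reprK (iota_class CstarNK d)) => ->;
have [] := (iota_classE _ _ _).1 (iota_reprK (iota_class CstarNK b)) => ->;
have [] := (iota_classE _ _ _).1 (iota_reprK (iota_class (@opprK C) c)) => ->;
have [] := (iota_classE _ _ _).1 (iota_reprK (iota_class (@opprK C) a)) => ->;
by rewrite ?PNa ?PNc ?PNb ?PNd.
Qed.

End XC.

Arguments XC_mul R x y : clear implicits.

(* Main.v *)
Require Import Defs.
From mathcomp Require Import all_fingroup all_boot all_order all_algebra.
From mathcomp Require Import all_classical all_reals all_analysis.
From mathcomp Require Import finmap multiset.

Set Implicit Arguments.
Unset Strict Implicit.
Unset Printing Implicit Defensive.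

Import GRing.Theory Num.Theory numFieldNormedType.Exports.
Local Open Scope mset_scope.

(** Suppose the 2-valued group is the quotient of G by an involutive
automorphism s, and let p : G -> XC be the resulting map, whose fibers are the
orbits {g, s g} and which satisfies p g * p k = [p (g k), p (g (s k))].

On the subgroup N of elements lying over ([c], [1]), s has to be inversion.
Indeed, a class ([c], [1]) is one of the two values of the square of
([c / 2], [1]), the other value being the identity, and an element obtained in
this way is inverted by s ([cover_double_inverted]).  An automorphism that acts
as inversion forces N to be commutative.

Now take g over ([0], [i]).  Its square lies over ([0], [-1]) = ([0], [1]), so
g has order 2, although the multiplication by i that it is to induce on C has
order 4.  Conjugation by g is an involution of N lying over [c] |-> [i c], and
it fixes m (g m g) for every m in N because N is commutative.  If m lies over
[1], this product lies over [1 + i] or [1 - i], whose classes are not fixed by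
multiplication by i: a contradiction. *)

Lemma seq_mset2 (K : choiceType) (a b : K) : seq_mset [:: a; b] = [mset a; b].
Proof.
apply/msetP => x; rewrite mset_seqE mset1DE msetnE /= addn0.
by rewrite [b == x]eq_sym [a == x]eq_sym; case: (x == b).
Qed.

Lemma mset2_eq (K : choiceType) (a b c d : K) :
  [mset a; b] = [mset c; d] -> (a = c /\ b = d) \/ (a = d /\ b = c).
Proof.
have mset1_inj (u v w : K) : [mset u; v] = [mset u; w] -> v = w.
  move=> /(congr1 (fun A => A `\ u)); rewrite !msetD1K => vw.
  by apply/eqP; rewrite -in_mset1 -vw in_mset1.
move=> E; have: a \in [mset c; d] by rewrite -E mset21.
case/mset2P=> ?; subst a; first by left; split=> //; apply: mset1_inj E.
by right; split=> //; move: E; rewrite [RHS]msetDC => /mset1_inj.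
Qed.

Lemma mset2_diag (K : choiceType) (a b c : K) :
  [mset a; b] = [mset c; c] -> a = c /\ b = c.
Proof. by move/mset2_eq=> [[-> ->]|[-> ->]]. Qed.

(** What remains of an identification of the 2-valued group (X, mul) with a
coset group for the action of {1, s} on gT, once it is read as the map p that
sends an element of gT to its orbit. *)
Definition involution_cover (gT : groupType) (s : gT -> gT) (X : choiceType)
    (mul : X -> X -> {mset X}) (p : gT -> X) : Prop :=
  [/\ {morph s : g k / (g * k)%g}, involutive s,
      forall g k, p g = p k <-> g = k \/ g = s k,
      forall x, exists g, p g = x &
      forall g k, mul (p g) (p k) = [mset p (g * k)%g; p (g * s k)%g]].

Section InvolutionCover.
Variables (gT : groupType) (s : gT -> gT) (X : choiceType).
Variables (mul : X -> X -> {mset X}) (p : gT -> X).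
Hypothesis cov : involution_cover s mul p.

Lemma cover_s1 : s 1%g = 1%g.
Proof.
have [sM _ _ _ _] := cov.
by apply: (mulIg (s 1%g)); rewrite -sM !mul1g.
Qed.

Lemma cover_sV g : s (g^-1)%g = ((s g)^-1)%g.
Proof.
have [sM _ _ _ _] := cov.
by apply: (mulIg (s g)); rewrite -sM !mulVg cover_s1.
Qed.

Lemma cover_fiber1 g : p g = p 1%g -> g = 1%g.
Proof. by have [_ _ pE _ _] := cov; case/pE; rewrite ?cover_s1. Qed.

(** The values p (y y) and p (y (s y)) of the square of p y are p x and the
identity.  If y (s y) is trivial then s inverts y, hence also y y; if y y is
trivial then s inverts y (s y), its inverse being (s y) y.  In either case s
inverts an element of the fiber {x, s x}, hence all of it. *)
Lemma cover_double_inverted x y :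
  mul (p y) (p y) = [mset p x; p 1%g] -> s x = (x^-1)%g.
Proof.
have [sM sK pE _ pM] := cov.
suff inv_fiber u : s u = (u^-1)%g -> p u = p x -> s x = (x^-1)%g.
  rewrite pM => /mset2_eq[[ux /cover_fiber1 ysy]|[/cover_fiber1 yy ux]].
    have sy : s y = (y^-1)%g by apply: (mulgI y); rewrite ysy mulgV.
    by apply: inv_fiber ux; rewrite sM sy invMg.
  apply: inv_fiber ux; rewrite sM sK; apply: (mulIg (y * s y)%g).
  by rewrite mulVg mulgA -[(s y * y * y)%g]mulgA yy mulg1 -sM yy cover_s1.
move=> su /pE[ux|ux]; first by rewrite -ux.
by move: su; rewrite ux sK => su; rewrite [in RHS]su invgK.
Qed.

End InvolutionCover.

Local Open Scope ring_scope.

Section Obstruction.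
Variable R : realType.

Lemma XC_class_eq (a c : C R) (b d : Cstar R) :
  XC_class a b = XC_class c d <-> (a = c \/ a = - c) /\ (b = d \/ b = CstarN d).
Proof.
rewrite -(iota_classE (@opprK (C R))) -(iota_classE (@CstarNK R)).
by split=> [[-> ->]|[ac bd]]; [|congr pair].
Qed.

Definition Cstar1 : Cstar R := mkCstar (oner_neq0 (C R)).
Definition Cstari : Cstar R := mkCstar (neq0Ci (C R)).

Lemma XC_class_repr (x : XC R) :
  XC_class (iota_repr x.1) (iota_repr x.2) = x.
Proof. by case: x => a b; rewrite /XC_class !iota_reprK. Qed.

Lemma Cstar1M (b : Cstar R) : CstarM Cstar1 b = b.
Proof. by apply/val_inj; rewrite /= mul1r. Qed.

Lemma CstarM1 (b : Cstar R) : CstarM b Cstar1 = b.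
Proof. by apply/val_inj; rewrite /= mulr1. Qed.

Lemma Cstar_sqri : CstarM Cstari Cstari = CstarN Cstar1.
Proof. by apply/val_inj; rewrite /= -expr2 sqrCi. Qed.

(** The class [i] has order 2 in the quotient of the nonzero complex numbers by
sign, while multiplication by i has order 4: the source of the obstruction. *)
Lemma XC_class_sqri (a : C R) :
  XC_class a (CstarM Cstari Cstari) = XC_class a Cstar1.
Proof. by apply/XC_class_eq; split; [left|right; exact: Cstar_sqri]. Qed.

Lemma XC_no_involution_cover (gT : groupType) (s : gT -> gT) (p : gT -> XC R) :
  ~ involution_cover s (XC_mul R) p.
Proof.
move=> cov; have [sM sK pE pS pM] := cov.
have s1 := cover_s1 cov.
have p1 : p 1%g = XC_class 0 Cstar1.
  have [g0 pg0] := pS (XC_class 0 Cstar1); rewrite -pg0.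
  have := pM g0 1%g; rewrite s1 mulg1 pg0.
  rewrite -[p 1%g]XC_class_repr XC_mulE /= mul1r add0r => /mset2_diag[<- _].
  by rewrite Cstar1M.
have inverted x c : p x = XC_class c Cstar1 -> s x = (x^-1)%g.
  move=> px; have [y py] := pS (XC_class (c / 2) Cstar1).
  apply: (cover_double_inverted cov (y := y)).
  by rewrite py XC_mulE /= mul1r CstarM1 subrr -splitr px p1.
have [g pg] := pS (XC_class 0 Cstari).
have gg : (g * g)%g = 1%g.
  apply: (cover_fiber1 cov); rewrite p1.
  have := pM g g; rewrite pg XC_mulE mulr0 subr0 addr0 XC_class_sqri.
  by move/esym/mset2_diag=> [].
have conj_mul x c : p x = XC_class c Cstar1 ->
    p (g * x * g)%g = XC_class ('i * c) Cstar1.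
  move=> px.
  have pgx : p (g * x)%g = XC_class ('i * c) Cstari.
    have := pM g x; rewrite pg px XC_mulE CstarM1 /= add0r sub0r.
    rewrite (_ : XC_class (- _) _ = XC_class ('i * c) Cstari); last first.
      by apply/XC_class_eq; split; [right|left].
    by move/esym/mset2_diag=> [].
  have := pM (g * x)%g g; rewrite pgx pg XC_mulE mulr0 subr0 addr0 XC_class_sqri.
  by move/esym/mset2_diag=> [].
have [m pm] := pS (XC_class 1 Cstar1).
pose t := (g * m * g)%g; have pt := conj_mul _ _ pm; rewrite -/t mulr1 in pt.
have [e e2 pmt] : exists2 e : C R, e ^+ 2 = 1 &
    p (m * t)%g = XC_class (1 + e * 'i) Cstar1.
  have := mset21 (p (m * t)%g) (p (m * s t)%g).
  rewrite -pM pm pt XC_mulE CstarM1 /= mul1r => /mset2P[->|->].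
    by exists (1 : C R); rewrite ?expr1n ?mul1r.
  by exists (- 1 : C R); rewrite ?sqrrN ?expr1n ?mulN1r.
(* s inverts m, t and m t, so m and t commute. *)
have mtC : (t * m)%g = (m * t)%g.
  apply: invg_inj; rewrite invMg -(inverted _ _ pm) -(inverted _ _ pt) -sM.
  exact: inverted pmt.
have mt_fixed : (g * (m * t) * g)%g = (m * t)%g.
  by rewrite -[RHS]mtC /t -!mulgA gg mulg1.
have /XC_class_eq[E _] :
    XC_class ('i * (1 + e * 'i)) Cstar1 = XC_class (1 + e * 'i) Cstar1.
  by rewrite -(conj_mul _ _ pmt) mt_fixed.
(* Squaring i w = w or i w = - w for w = 1 + e i gives w = 0, whereas w divides
   2 = (1 + e i) (1 - e i). *)
have w2 : (1 + e * 'i) ^+ 2 = 0.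
  have Ew : - (1 + e * 'i) ^+ 2 = (1 + e * 'i) ^+ 2.
    rewrite -mulN1r -(sqrCi (C R)) -exprMn.
    by case: E => ->; rewrite ?sqrrN.
  by apply/eqP; rewrite -eqNr Ew.
have w0 : 1 + e * 'i = 0 by apply/eqP; rewrite -sqrf_eq0 w2.
have : (1 + e * 'i) * (1 - e * 'i) = 2.
  by rewrite mulrC -subr_sqr expr1n exprMn e2 sqrCi mul1r opprK.
by rewrite w0 mul0r => /esym/eqP; rewrite pnatr_eq0.
Qed.

End Obstruction.

Lemma group2_involution (H : finGroupType) : #|H| = 2%N ->
  exists h : H, perm_eq (enum H) [:: 1%g; h] /\ (h * h = 1)%g.
Proof.
move=> H2.
have [h hE] : exists h : H, perm_eq (enum H) [:: 1%g; h].
  have E1 : 1%g \in enum H by rewrite mem_enum.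
  have := perm_to_rem E1; have := size_rem E1; rewrite -cardE H2.
  by case: (rem _ _) => [|h []]// _ E; exists h.
exists h; split=> //.
have : (h * h)%g \in enum H by rewrite mem_enum.
rewrite (perm_mem hE) !inE => /orP[/eqP//|/eqP hh].
have := enum_uniq H; rewrite (perm_uniq hE) /= inE.
by rewrite (mulgI h 1%g h) ?eqxx// mulg1 hh.
Qed.

Theorem theorem1p7 (R : realType) :
  ~ exists (G : topologicalGroupType) (H : finGroupType)
           (psi : {multiplicative H -> topAut G}),
      #|H| = 2%N /\
      top_multivalued_isomorphic (XC_mul R) (coset_group_mul psi).
Proof.
case=> G [H [psi [H2 [f [[_ [f' [fK f'K _]]] fM]]]]].
have [h [enumH hh]] := group2_involution H2.
apply: (@XC_no_involution_cover R G (psi h) (f' \o orbit_class psi)); split.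
- exact: psi_morph.
- by move=> x; rewrite -psiM hh psi1.
- move=> g k; split=> [/= /(can_inj f'K)/orbit_classE[j jE]|[->//|->]] /=; last first.
    by congr f'; apply/orbit_classE; exists h; rewrite -psiM hh psi1.
  have : j \in enum H by rewrite mem_enum.
  rewrite (perm_mem enumH) !inE => /orP[]/eqP jh; move: jE; rewrite jh ?psi1; first by left.
  by move=> <-; right; rewrite -psiM hh psi1.
- by move=> x; exists (orbit_repr (f x)); rewrite /= orbit_reprK fK.
- move=> g k.
  rewrite -seq_mset2 -[LHS]seq_mset_id; apply/eq_seq_msetP.
  have := fM (f' (orbit_class psi g)) (f' (orbit_class psi k)).
  rewrite !f'K coset_group_mulE => /eq_seq_msetP/(perm_map f').
  rewrite (mapK fK) perm_sym => /permPl->.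
  rewrite -map_comp.
  by rewrite (permPl (perm_map _ enumH)) /= psi1.
Qed.
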